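(* Let $(\mathfrak{A},\Phi,\varphi)$ be a C*-dynamical system such that $\Phi$ is a homomorphism admitting a $\varphi$-adjoint and $\Omega_\varphi$ is a cyclic vector for $\pi_\varphi(\mathfrak{A})'$. Let $(\widehat{\mathfrak{M}},\widehat\Phi,\widehat\varphi)$ be the reversible dilation of the associated W*-dynamical system $(\pi_\varphi(\mathfrak{A})'',\Phi_\bullet,\varphi_\bullet)$ constructed from the covariant GNS representation $(\pi_\infty,\mathcal{H}_\infty,\Omega_\infty,\mathbf{V}_\infty)$, i.e. $\widehat{\mathfrak{M}}=\mathfrak{B}''$ with $\mathfrak{B}$ the unital *-subalgebra of $\mathcal{B}(\mathcal{H}_\infty)$ generated by $\bigcup_{n\in\mathbb{N}}\{\mathbf{V}_\infty^n\pi_\infty(a)\mathbf{V}_\infty^{*n}:a\in\mathfrak{A}\}$, $\widehat\Phi(X)=\mathbf{V}_\infty^*X\mathbf{V}_\infty$ and $\widehat\varphi(X)=\langle\Omega_\infty,X\Omega_\infty\rangle$ for $X\in\widehat{\mathfrak{M}}$. If $(\mathfrak{A},\Phi,\varphi)$ is ergodic, then $(\widehat{\mathfrak{M}},\widehat\Phi,\widehat\varphi)$ is ergodic; if $(\mathfrak{A},\Phi,\varphi)$ is weakly mixing, then $(\widehat{\mathfrak{M}},\widehat\Phi,\widehat\varphi)$ is weakly mixing.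
   Context: A C*-dynamical system is a triple $(\mathfrak{A},\Phi,\varphi)$ with $\mathfrak{A}$ a unital C*-algebra, $\Phi:\mathfrak{A}\to\mathfrak{A}$ a unital completely positive map (ucp-map) and $\varphi$ a state with $\varphi\circ\Phi=\varphi$. A W*-dynamical system is such a triple with $\mathfrak{A}$ a von Neumann algebra, $\Phi$ normal and $\varphi$ normal and faithful. Homomorphisms and representations are unital and *-preserving; inner products are linear in the second variable; $\mathbb{N}=\{0,1,2,\dots\}$. The system $(\mathfrak{A},\Phi,\varphi)$ is ergodic if $\lim_{n\to\infty}\frac1{n+1}\sum_{k=0}^n[\varphi(a\Phi^k(b))-\varphi(a)\varphi(b)]=0$ for all $a,b\in\mathfrak{A}$, and weakly mixing if $\lim_{n\to\infty}\frac1{n+1}\sum_{k=0}^n|\varphi(a\Phi^k(b))-\varphi(a)\varphi(b)|=0$ for all $a,b\in\mathfrak{A}$. A $\varphi$-adjoint of $\Phi$ is a ucp-map $\Phi^\sharp:\mathfrak{A}\to\mathfrak{A}$ with $\varphi(a\Phi^\sharp(b))=\varphi(\Phi(a)b)$ for all $a,b\in\mathfrak{A}$. $(\mathcal{H}_\varphi,\pi_\varphi,\Omega_\varphi)$ is the GNS representation of $\varphi$, and $\mathbf{U}_{\Phi,\varphi}$ is the unique contraction on $\mathcal{H}_\varphi$ with $\mathbf{U}_{\Phi,\varphi}\pi_\varphi(a)\Omega_\varphi=\pi_\varphi(\Phi(a))\Omega_\varphi$. If $\Omega_\varphi$ is cyclic for $\pi_\varphi(\mathfrak{A})'$, the associated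 W*-dynamical system is $(\pi_\varphi(\mathfrak{A})'',\Phi_\bullet,\varphi_\bullet)$ with $\Phi_\bullet(X)\Omega_\varphi=\mathbf{U}_{\Phi,\varphi}X\Omega_\varphi$ and $\varphi_\bullet(X)=\langle\Omega_\varphi,X\Omega_\varphi\rangle$. The covariant GNS representation of $(\mathfrak{A},\Phi,\varphi)$ is the quadruple $(\pi_\infty,\mathcal{H}_\infty,\Omega_\infty,\mathbf{V}_\infty)$, unique up to unitary equivalence, consisting of a representation $\pi_\infty$ of $\mathfrak{A}$ on a Hilbert space $\mathcal{H}_\infty$, a vector $\Omega_\infty$ and an isometry $\mathbf{V}_\infty$ on $\mathcal{H}_\infty$, together with a linear isometry $Z_0:\mathcal{H}_\varphi\to\mathcal{H}_\infty$, such that: $\pi_\infty(a)Z_0=Z_0\pi_\varphi(a)$; $\Omega_\infty=Z_0\Omega_\varphi$; $(\mathbf{U}_{\Phi,\varphi}^* )^n=Z_0^*\mathbf{V}_\infty^nZ_0$ for $n\in\mathbb{N}$; $\mathbf{V}_\infty\Omega_\infty=\Omega_\infty$; $\Omega_\infty$ is cyclic for the *-algebra generated by all $\mathbf{V}_\infty^n\pi_\infty(a)\mathbf{V}_\infty^{*n}$ ($n\ge0$, $a\in\mathfrak{A}$); $\pi_\infty(\Phi(a))=\mathbf{V}_\infty^*\pi_\infty(a)\mathbf{V}_\infty$ and $\varphi(a)=\langle\Omega_\infty,\pi_\infty(a)\Omega_\infty\rangle$ for $a\in\mathfrak{A}$. When $\Phi$ is a homomorphism, $\mathbf{V}_\infty$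 is unitary. Under the hypotheses of the claim, $(\widehat{\mathfrak{M}},\widehat\Phi,\widehat\varphi)$ is a W*-dynamical system with $\widehat\Phi$ an automorphism, and is a reversible dilation of $(\pi_\varphi(\mathfrak{A})'',\Phi_\bullet,\varphi_\bullet)$ via the normal ucp-map $\mathcal{E}:\widehat{\mathfrak{M}}\to\pi_\varphi(\mathfrak{A})''$ satisfying $\mathcal{E}(\mathbf{V}_\infty^k\pi_\infty(a)\mathbf{V}_\infty^{*k})=\pi_\varphi(\Phi^{\sharp k}(a))$ for $a\in\mathfrak{A}$, $k\in\mathbb{N}$, and the normal injective homomorphism $i:\pi_\varphi(\mathfrak{A})''\to\widehat{\mathfrak{M}}$ with $i(A)\Omega_\infty=Z_0A\Omega_\varphi$; that is, $\mathcal{E}(i(A)X)=A\mathcal{E}(X)$, $\mathcal{E}(\widehat\Phi^n(i(A)))=\Phi_\bullet^n(A)$ and $\widehat\varphi(X)=\varphi_\bullet(\mathcal{E}(X))$ for $A\in\pi_\varphi(\mathfrak{A})''$, $X\in\widehat{\mathfrak{M}}$, $n\in\mathbb{N}$. *)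

(* Defs.v *)
From HB Require Import structures.
From mathcomp Require Import all_boot all_order all_algebra.
From mathcomp Require Import complex.
From mathcomp Require Import all_classical all_reals all_analysis.
Set Implicit Arguments.
Unset Strict Implicit.
Unset Printing Implicit Defensive.
Import Order.TTheory GRing.Theory Num.Theory.
Import numFieldNormedType.Exports.
Local Open Scope classical_set_scope.
Local Open Scope ring_scope.
Local Open Scope complex_scope.

HB.mixin Record CompleteNormedModule_isHilbert (R : realType) H
    of CompleteNormedModule R[i] H := {
  dotp : H -> H -> R[i];
  dotp_linear : forall x a y z, dotp x (a *: y + z) = a * dotp x y + dotp x z;
  dotpC : forall x y, dotp x y = Num.conj (dotp y x);
  dotp_norm : forall x : H, dotp x x = `|x| ^+ 2
}.

#[short(type="hilbertType")]
HB.structure Definition Hilbert (R : realType) :=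
  {H of CompleteNormedModule R[i] H & CompleteNormedModule_isHilbert R H}.

(* The ring and normed-module hierarchies already meet in numDomainType, so HB
   admits no further structure inheriting from both: the norm of a C*-algebra
   and its completeness are stated here directly. Algebras are non-trivial
   rings, which is no restriction for an algebra that carries a state. *)
HB.mixin Record Algebra_isCStar (R : realType) A of GRing.Algebra R[i] A := {
  star : A -> A;
  cnorm : A -> R;
  starK : involutive star;
  star_semilinear : forall (c : R[i]) (a b : A),
    star (c *: a + b) = Num.conj c *: star a + star b;
  starM : forall a b, star (a * b) = star b * star a;
  cnorm_eq0 : forall a, cnorm a = 0 -> a = 0;
  cnormD : forall a b, cnorm (a + b) <= cnorm a + cnorm b;
  cnormZ : forall (c : R[i]) (a : A), (cnorm (c *: a))%:C = `|c| * (cnorm a)%:C;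
  cnormM : forall a b, cnorm (a * b) <= cnorm a * cnorm b;
  cnorm_star : forall a, cnorm (star a * a) = cnorm a ^+ 2;
  cnorm_complete : forall u : nat -> A,
    (forall e : R, 0 < e -> exists N, forall m n,
       (N <= m)%N -> (N <= n)%N -> cnorm (u m - u n) < e) ->
    exists l, forall e : R, 0 < e -> exists N, forall n,
       (N <= n)%N -> cnorm (u n - l) < e
}.

#[short(type="cstarType")]
HB.structure Definition CStar (R : realType) :=
  {A of GRing.Algebra R[i] A & Algebra_isCStar R A}.

Section Operators.
Context {R : realType}.

Definition bounded_operator (H K : hilbertType R) : set (H -> K) :=
  [set T | linear T /\ exists M : R, forall x, `|T x| <= M%:C * `|x|].

(* [adjoint T y] is the Riesz representative of [x |-> dotp y (T x)]; it exists
   and is unique for bounded [T], the only case in which it is used. *)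
Definition adjoint (H K : hilbertType R) (T : H -> K) : K -> H :=
  fun y => get [set z : H | forall x, dotp z x = dotp y (T x)].

Definition commutant (H : hilbertType R) (S : set (H -> H)) : set (H -> H) :=
  [set T | bounded_operator T /\ forall X, S X -> T \o X = X \o T].

Definition cyclic_vector (H : hilbertType R) (S : set (H -> H)) (x : H) : Prop :=
  dense [set T x | T in S].

Record unital_star_subalgebra (H : hilbertType R) (S : set (H -> H)) : Prop := {
  ussa_bounded : S `<=` bounded_operator (K := H);
  ussa_id : S id;
  ussa_lin : forall (c : R[i]) X Y, S X -> S Y -> S (fun x => c *: X x + Y x);
  ussa_comp : forall X Y, S X -> S Y -> S (X \o Y);
  ussa_adj : forall X, S X -> S (adjoint X)
}.

Definition linear_isometry (H K : hilbertType R) (T : H -> K) : Prop :=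
  linear T /\ forall x, `|T x| = `|x|.

Definition linear_contraction (H K : hilbertType R) (T : H -> K) : Prop :=
  linear T /\ forall x, `|T x| <= `|x|.

End Operators.

Section CStarMaps.
Context {R : realType} {A : cstarType R}.

Definition mx_star n (X : 'M[A]_n) : 'M[A]_n := (map_mx star X)^T.

Definition mx_positive n (X : 'M[A]_n) : Prop :=
  exists Y : 'M[A]_n, X = mx_star Y *m Y.

Definition completely_positive (Phi : A -> A) : Prop :=
  forall n (X : 'M[A]_n), mx_positive X -> mx_positive (map_mx Phi X).

Record ucp_map (Phi : A -> A) : Prop := {
  ucp_linear : linear Phi;
  ucp_unital : Phi 1 = 1;
  ucp_cp : completely_positive Phi
}.

Record state (phi : A -> R[i]) : Prop := {
  state_linear : scalar phi;
  state_ge0 : forall a, 0 <= phi (star a * a);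
  state1 : phi 1 = 1
}.

Record cstar_dynamical_system (Phi : A -> A) (phi : A -> R[i]) : Prop := {
  cds_ucp : ucp_map Phi;
  cds_state : state phi;
  cds_invariant : forall a, phi (Phi a) = phi a
}.

Record star_homomorphism (Phi : A -> A) : Prop := {
  shom_linear : linear Phi;
  shom1 : Phi 1 = 1;
  shomM : forall a b, Phi (a * b) = Phi a * Phi b;
  shom_star : forall a, Phi (star a) = star (Phi a)
}.

Definition phi_adjoint (Phi : A -> A) (phi : A -> R[i]) (Phis : A -> A) : Prop :=
  ucp_map Phis /\ forall a b, phi (a * Phis b) = phi (Phi a * b).

Record representation (H : hilbertType R) (pi : A -> H -> H) : Prop := {
  rep_bounded : forall a, bounded_operator (pi a);
  rep_linear : forall (c : R[i]) a b x, pi (c *: a + b) x = c *: pi a x + pi b x;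
  rep1 : pi 1 = id;
  repM : forall a b, pi (a * b) = pi a \o pi b;
  rep_star : forall a, pi (star a) = adjoint (pi a)
}.

Record GNS_representation (phi : A -> R[i]) (H : hilbertType R)
    (pi : A -> H -> H) (Om : H) : Prop := {
  GNS_rep : representation pi;
  GNS_cyclic : cyclic_vector (range pi) Om;
  GNS_state : forall a, phi a = dotp Om (pi a Om)
}.

Definition GNS_contraction (Phi : A -> A) (H : hilbertType R)
    (pi : A -> H -> H) (Om : H) (U : H -> H) : Prop :=
  linear_contraction U /\ forall a, U (pi a Om) = pi (Phi a) Om.

Definition covariance_algebra (H : hilbertType R) (pi : A -> H -> H)
    (V : H -> H) : set (H -> H) :=
  smallest (unital_star_subalgebra (H := H))
    (\bigcup_n [set iter n V \o pi a \o iter n (adjoint V) | a in [set: A]]).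

Record covariant_GNS_representation (Phi : A -> A) (phi : A -> R[i])
    (H : hilbertType R) (pi : A -> H -> H) (Om : H) (U : H -> H)
    (Hinf : hilbertType R) (piinf : A -> Hinf -> Hinf) (Ominf : Hinf)
    (V : Hinf -> Hinf) (Z0 : H -> Hinf) : Prop := {
  cGNS_rep : representation piinf;
  cGNS_V : linear_isometry V;
  cGNS_Z0 : linear_isometry Z0;
  cGNS_intertwine : forall a, piinf a \o Z0 = Z0 \o pi a;
  cGNS_vector : Ominf = Z0 Om;
  cGNS_dilation : forall n, iter n (adjoint U) = adjoint Z0 \o iter n V \o Z0;
  cGNS_fixed : V Ominf = Ominf;
  cGNS_cyclic : cyclic_vector (covariance_algebra piinf V) Ominf;
  cGNS_covariant : forall a, piinf (Phi a) = adjoint V \o piinf a \o V;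
  cGNS_state : forall a, phi a = dotp Ominf (piinf a Ominf)
}.

End CStarMaps.

Section ReversibleDilation.
Context {R : realType} {A : cstarType R} {H : hilbertType R}.

Definition dilation_algebra (pi : A -> H -> H) (V : H -> H) : set (H -> H) :=
  commutant (commutant (covariance_algebra pi V)).

Definition dilation_map (V X : H -> H) : H -> H := adjoint V \o X \o V.

Definition vector_state (Om : H) (X : H -> H) : R[i] := dotp Om (X Om).

End ReversibleDilation.

(* Mixing properties of a triple whose algebra is a subset [M] of a type [T]
   with product [mul]: [M] is everything for a C*-algebra, and a von Neumann
   algebra in [H -> H] with [mul] the composition for operator systems. *)
Section Mixing.
Context {R : realType} {T : Type}.
Variables (mul : T -> T -> T) (M : set T) (Phi : T -> T) (phi : T -> R[i]).

Definition correlation (a b : T) (k : nat) : R[i] :=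
  phi (mul a (iter k Phi b)) - phi a * phi b.

Definition ergodic : Prop := forall a b, M a -> M b ->
  (fun n => n.+1%:R^-1 * \sum_(0 <= k < n.+1) correlation a b k)
    @ \oo --> (0 : R[i]^o).

Definition weakly_mixing : Prop := forall a b, M a -> M b ->
  (fun n => n.+1%:R^-1 * \sum_(0 <= k < n.+1) `|correlation a b k|)
    @ \oo --> (0 : R[i]^o).

End Mixing.

(* Main.v *)
Require Import Defs.
From mathcomp Require Import all_boot all_order all_algebra.
From mathcomp Require Import complex.
From mathcomp Require Import all_classical all_reals all_analysis.
From mathcomp Require Import ring lra.
Import Order.TTheory GRing.Theory Num.Theory.
Import numFieldNormedType.Exports.
Local Open Scope classical_set_scope.
Local Open Scope ring_scope.
Local Open Scope complex_scope.

(** Since [V] fixes the vacuum [Om], the correlations of the dilation are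
    matrix coefficients of the powers of [V^*]: for [X], [Y] in the von Neumann
    algebra, [<Om, X Phihat^k(Y) Om> - <Om, X Om> <Om, Y Om>] is the value at
    [x = X^* Om], [y = Y Om] of the sesquilinear form
    [c_k(x, y) = <x, V^{*k} y> - <x, Om> <Om, y>]
    ([dilation_correlation]).  As [V^*] is a contraction and [Om] a unit vector,
    [|c_k(x, y)| <= 2 |x| |y|] uniformly in [k], so the set of vectors for
    which the Cesaro means of [c_k], or of [|c_k|], tend to zero is closed in
    each variable ([cesaro_null_dense]).  It is thus enough to find a dense set
    of vectors on which mixing of the original system gives the conclusion.

    The dense set is that of the vectors [V^n rho(a) Om].  Multiplicativity of
    [Phi] and the covariance [rho(Phi a) = V^* rho(a) V] yield the commutation
    [rho(a) V = V rho(Phi a)] ([rep_isometry]).  It shows that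
    [V^n rho(a) Om = V^(m + n) rho(Phi^m a) Om], so that two such vectors may
    be written with the same power of [V], and that they form a subspace
    invariant under each generator [V^n rho(a) V^{*n}] and its adjoint, hence
    under the whole algebra that these generate
    ([covariance_algebra_vacuum_orbit]).
    That subspace contains [Om], which is cyclic, so it is dense.  Finally,
    because [V] is isometric,
    [c_k(V^n rho(a) Om, V^n rho(b) Om) = phi(a^* Phi^k(b)) - phi(a^* ) phi(b)],
    the correlation of the original system ([vector_correlation_vacuum_orbit]).

    Adjoints are defined by a choice of Riesz representatives, whose existence
    is proved by minimising the energy functional ([riesz]). *)

(** * Inner products *)

Section DotProduct.
Context {R : realType} {H : hilbertType R}.
Implicit Types (x y z : H) (a : R[i]).

Lemma dotp0r x : dotp x 0 = 0.
Proof.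
have := dotp_linear x 1 0 0.
by rewrite scaler0 addr0 mul1r -[X in X = _]addr0 => /addrI.
Qed.

Lemma dotpDr x y z : dotp x (y + z) = dotp x y + dotp x z.
Proof. by have := dotp_linear x 1 y z; rewrite scale1r mul1r. Qed.

Lemma dotpZr a x y : dotp x (a *: y) = a * dotp x y.
Proof. by have := dotp_linear x a y 0; rewrite dotp0r !addr0. Qed.

Lemma dotpNr x y : dotp x (- y) = - dotp x y.
Proof. by rewrite -scaleN1r dotpZr mulN1r. Qed.

Lemma dotpBr x y z : dotp x (y - z) = dotp x y - dotp x z.
Proof. by rewrite dotpDr dotpNr. Qed.

Lemma dotpDl x y z : dotp (x + y) z = dotp x z + dotp y z.
Proof. by rewrite dotpC dotpDr rmorphD/= -!dotpC. Qed.

Lemma dotpZl a x y : dotp (a *: x) y = Num.conj a * dotp x y.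
Proof. by rewrite dotpC dotpZr rmorphM/= -dotpC. Qed.

Lemma dotpNl x y : dotp (- x) y = - dotp x y.
Proof. by rewrite dotpC dotpNr rmorphN/= -dotpC. Qed.

Lemma dotpBl x y z : dotp (x - y) z = dotp x z - dotp y z.
Proof. by rewrite dotpDl dotpNl. Qed.

Lemma dotp_eq0 x : (dotp x x == 0) = (x == 0).
Proof. by rewrite dotp_norm sqrf_eq0 normr_eq0. Qed.

Lemma dotp_inj x y : (forall z, dotp x z = dotp y z) -> x = y.
Proof.
by move=> xy; apply/subr0_eq/eqP; rewrite -dotp_eq0 dotpBl xy subrr.
Qed.

(** Expand the square of the norm of [|y|^2 x - <y, x> y], which avoids
    dividing by [|y|^2]. *)
Lemma cauchy_schwarz x y : `|dotp x y| <= `|x| * `|y|.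
Proof.
have [->|y0] := eqVneq y 0; first by rewrite dotp0r !normr0 mulr0.
have ny0 : 0 < `|y| ^+ 2 by rewrite exprn_gt0// normr_gt0.
rewrite -(@ler_pXn2r _ 2) ?nnegrE ?mulr_ge0// exprMn -subr_ge0.
rewrite -(pmulr_rge0 _ ny0).
have : 0 <= `| (`|y| ^+ 2) *: x - dotp y x *: y| ^+ 2 by rewrite exprn_ge0.
rewrite -dotp_norm dotpBl !dotpBr !dotpZl !dotpZr !dotp_norm -(dotpC x y).
rewrite (dotpC y x) normCK conj_Creal ?normr_real ?realX ?ger0_real//.
move/le_trans; apply; rewrite le_eqVlt; apply/orP; left; apply/eqP; ring.
Qed.

End DotProduct.

(** * The Riesz representation theorem *)

Section Riesz.
Context {R : realType} {H : hilbertType R}.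
Local Notation Re := (@complex.Re R).

Lemma ReD (a b : R[i]) : Re (a + b) = Re a + Re b.
Proof. by case: a; case: b. Qed.

Lemma ReN (a : R[i]) : Re (- a) = - Re a.
Proof. by case: a. Qed.

Lemma Re_conjC (a : R[i]) : Re (Num.conj a) = Re a.
Proof. by case: a. Qed.

Lemma ReMr (t : R) (a : R[i]) : Re (t%:C * a) = t * Re a.
Proof. by case: a => a b /=; rewrite mul0r subr0. Qed.

Lemma conjCr (t : R) : Num.conj (t%:C) = t%:C.
Proof. exact: conjc_real. Qed.

(** The squared norm as a real number: the norm of a Hilbert space takes values
    in the partially ordered [R[i]], while the minimisation below needs an
    infimum in [R]. *)
Definition sqn (x : H) : R := Re (dotp x x).

Lemma sqnE x : (sqn x)%:C = `|x| ^+ 2.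
Proof. by rewrite /sqn RRe_real dotp_norm// realX// normr_real. Qed.

Lemma sqn_ge0 x : 0 <= sqn x.
Proof. by rewrite -ler0c sqnE exprn_ge0. Qed.

Lemma norm_lt_sqn x (e : R) : 0 < e -> (`|x| < e%:C) = (sqn x < e ^+ 2).
Proof.
move=> e0; rewrite -ltcR sqnE rmorphXn/= ltr_pXn2r ?nnegrE//.
by rewrite ler0c ltW.
Qed.

Lemma sqnN x : sqn (- x) = sqn x.
Proof. by rewrite /sqn dotpNl dotpNr opprK. Qed.

(** Evaluate at the minimum [t = - b / c]; for [c = 0] the slope [b] must
    vanish. *)
Lemma quadratic_ge0 (a b c : R) : 0 <= c ->
  (forall t, 0 <= a + 2 * t * b + t ^+ 2 * c) -> b ^+ 2 <= a * c.
Proof.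
rewrite le_eqVlt => /predU1P[<-|c0] ht.
  have [->|b0] := eqVneq b 0; first by rewrite expr0n/= mulr0.
  have := ht (- (a + 1) / (2 * b)).
  have -> : a + 2 * (- (a + 1) / (2 * b)) * b
      + (- (a + 1) / (2 * b)) ^+ 2 * 0 = - 1 by field.
  by rewrite oppr_ge0 ler10.
have := ht (- b / c).
have -> : a + 2 * (- b / c) * b + (- b / c) ^+ 2 * c = (a * c - b ^+ 2) / c.
  by field; rewrite gt_eqF.
by rewrite pmulr_lge0 ?invr_gt0// subr_ge0.
Qed.

Lemma double_le_add {r s p : R} :
  r ^+ 2 <= p * s -> 0 <= s -> 0 <= p -> 2 * r <= s + p.
Proof.
move=> fr s0 p0; rewrite leNgt; apply/negP => h.
have h1 : 0 < (2 * r - s - p) ^+ 2 by rewrite exprn_gt0//; lra.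
have h2 : 0 <= (s + p) * (2 * r - s - p) by rewrite mulr_ge0//; lra.
have h3 := sqr_ge0 (s - p); lra.
Qed.

(** The energy [J z = |z|^2 - 2 Re (f z)] is bounded below.  Its expansion
    along the line [z + t x] is quadratic in [t] with slope
    [2 Re (<z, x> - f x)] at [0].  Convexity makes a minimising sequence
    Cauchy, and at its limit the slope vanishes in every direction. *)
Lemma riesz (f : H -> R[i]) : scalar f ->
  (exists M : R, forall x, `|f x| <= M%:C * `|x|) ->
  exists z, forall x, dotp z x = f x.
Proof.
move=> flin [M fM].
have fD x y : f (x + y) = f x + f y.
  by have := flin 1 x y; rewrite scale1r mul1r.
have f0 : f 0 = 0 by apply: (addrI (f 0)); rewrite -fD !addr0.
have fZ a x : f (a *: x) = a * f x.
  by have := flin a x 0; rewrite f0 !addr0.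
pose J z := sqn z - 2 * Re (f z).
pose g z x := Re (dotp z x - f x).
have JE z x (t : R) : J (z + t%:C *: x) = J z + 2 * t * g z x + t ^+ 2 * sqn x.
  rewrite /J /g /sqn dotpDl !dotpDr !dotpZl !dotpZr fD fZ conjCr.
  rewrite !(ReD, ReN, ReMr) (dotpC x z) Re_conjC; ring.
have Jlb z : - M ^+ 2 <= J z.
  have fr : Re (f z) ^+ 2 <= M ^+ 2 * sqn z.
    rewrite -lecR.
    have -> : (M ^+ 2 * sqn z)%:C = (M%:C * `|z|) ^+ 2.
      by rewrite rmorphM/= sqnE rmorphXn exprMn.
    apply: (@le_trans _ _ (`|f z| ^+ 2)).
      by rewrite -add_Re2_Im2 lecR lerDl sqr_ge0.
    rewrite lerXn2r ?nnegrE//.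
    by rewrite (le_trans _ (fM z)).
  move: fr (sqn_ge0 z) (sqr_ge0 M); rewrite /J.
  move: (Re (f z)) (sqn z) (M ^+ 2) => r s p fr s0 p0.
  have := double_le_add fr s0 p0; clear; lra.
pose m := inf (range J).
have hm : has_inf (range J).
  split; first by exists (J 0), 0.
  by exists (- M ^+ 2) => _ [z _ <-].
have mle z : m <= J z by apply: ge_inf; [case: hm | exists z].
have gle z x e : J z <= m + e -> g z x ^+ 2 <= e * sqn x.
  move=> Jz; apply: quadratic_ge0; first exact: sqn_ge0.
  by move=> t; have := mle (z + t%:C *: x); rewrite JE; lra.
have /choice[u hu] n : exists z, J z <= m + n.+1%:R^-1.
  have n0 : 0 < n.+1%:R^-1 :> R by rewrite invr_gt0.
  have [_ [z _ <-] /ltW zm] := inf_adherent n0 hm.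
  by exists z.
have inv_lt (e : R) : 0 < e -> exists N, forall n, (N <= n)%N -> n.+1%:R^-1 < e.
  move=> e0; have [N _ hN] := near_infty_natSinv_lt (PosNum e0).
  by exists N => n /hN.
have cu : cauchy (u @ \oo).
  apply: cauchy_exP => e e0.
  have eE : e = (Re e)%:C by rewrite RRe_real// gtr0_real.
  have e'0 : 0 < Re e by rewrite -ltcR -eE.
  have [N hN] := inv_lt (Re e ^+ 2 / 4) ltac:(by rewrite divr_gt0// exprn_gt0).
  exists (u N), N => // n /= Nn.
  rewrite -ball_normE/= eE; rewrite norm_lt_sqn// -sqnN opprB.
  (* The energy at the midpoint is at least the infimum, which bounds the
     quadratic term of the energy between the two points. *)
  have mid := mle (u N + (2^-1)%:C *: (u n - u N)).
  have := JE (u N) (u n - u N) 1.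
  have E1 : u N + 1%:C *: (u n - u N) = u n by rewrite scale1r addrC subrK.
  rewrite E1; rewrite JE in mid.
  have := hu N; have := hu n; have := hN _ Nn; have := hN _ (leqnn N).
  move: mid; move: (m) (J (u n)) (J (u N)) (g _ _) (sqn _) => k a b c d.
  move: (N.+1%:R^-1) (n.+1%:R^-1) => p q; clear; lra.
have [z uz] : exists z : H, u @ \oo --> z.
  by exists (lim (u @ \oo)); exact: cauchy_cvg.
have Jz : J z <= m.
  apply/ler_addgt0Pr => e e0.
  pose d := Num.min (e / 4) 1.
  have d0 : 0 < d by rewrite lt_min divr_gt0//=.
  have [N hN] := inv_lt _ d0.
  have /cvgrPdist_lt /(_ (d%:C)) := uz.
  rewrite ltcR => /(_ d0) [N' _ hN'].
  pose n := maxn N N'.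
  have := hN' n (leq_maxr _ _); rewrite /= => uzn.
  have s1 : sqn (z - u n) < d ^+ 2 by rewrite -norm_lt_sqn.
  (* Expanding at [u n], where the slope is already small, spares a proof that
     the energy is continuous. *)
  have := JE (u n) (z - u n) 1.
  have E1 : u n + 1%:C *: (z - u n) = z by rewrite scale1r addrC subrK.
  rewrite E1 => ->.
  have := gle _ (z - u n) _ (hu n).
  have := hu n; have := hN n (leq_maxl _ _).
  set v := n.+1%:R^-1; have v0 : 0 < v by rewrite invr_gt0.
  have s0 := sqn_ge0 (z - u n).
  have de : d <= e / 4 by rewrite ge_min lexx.
  have d1 : d <= 1 by rewrite ge_min lexx orbT.
  move=> vd Jun gg.
  have sd : sqn (z - u n) <= d by nra.
  have gd : g (u n) (z - u n) <= d by nra.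
  lra.
have gz x : g z x = 0.
  apply/eqP; rewrite -sqrf_eq0 eq_le sqr_ge0 andbT.
  by rewrite (le_trans (gle z x 0 _)) ?addr0 ?mul0r.
exists z => x; apply/eqP; rewrite eq_complex; apply/andP; split.
  have := gz x; rewrite /g ReD ReN => /eqP; by rewrite subr_eq0.
(* Up to sign, the imaginary part is the real part in the direction [i x]. *)
have := gz ('i%C *: x); rewrite /g fZ dotpZr -mulrBr.
case: (dotp z x) => a b; case: (f x) => c d /=.
by rewrite mul0r mul1r add0r/= => /eqP; rewrite ?oppr_eq0 ?subr_eq0.
Qed.
End Riesz.

(** * Adjoints of bounded operators and isometries *)

Section BoundedOperators.
Context {R : realType}.
Implicit Types H K L : hilbertType R.

(** The map [S] itself exhibits the representatives that [adjoint] chooses, and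
    these are unique. *)
Lemma adjoint_eq {H K} (T : H -> K) (S : K -> H) :
  (forall x y, dotp (S y) x = dotp y (T x)) -> adjoint T = S.
Proof.
move=> TS; apply/funext => y; apply: dotp_inj => x; rewrite TS.
apply: (getPex (P := [set z | forall x, dotp z x = dotp y (T x)])).
by exists (S y).
Qed.

Lemma dotp_adjointl {H K} {T : H -> K} : bounded_operator T ->
  forall x y, dotp (adjoint T y) x = dotp y (T x).
Proof.
move=> [Tlin [M TM]] x y; move: x.
apply: (getPex (P := [set z | forall x, dotp z x = dotp y (T x)])).
apply: riesz.
  by move=> a u v; rewrite Tlin dotpDr dotpZr.
exists (M * complex.Re `|y|) => x.
rewrite (le_trans (cauchy_schwarz _ _))// rmorphM/= RRe_real ?normr_real//.
by rewrite mulrAC [leRHS]mulrC ler_wpM2l.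
Qed.

Lemma dotp_adjointr {H K} {T : H -> K} : bounded_operator T ->
  forall x y, dotp y (adjoint T x) = dotp (T y) x.
Proof. by move=> bT x y; rewrite dotpC dotp_adjointl// -dotpC. Qed.

Lemma bounded_operator_adjoint {H K} {T : H -> K} :
  bounded_operator T -> bounded_operator (adjoint T).
Proof.
move=> bT; have [Tlin [M TM]] := bT; split.
  move=> a u v; apply: dotp_inj => x.
  by rewrite dotpDl dotpZl !(dotp_adjointl bT) dotpDl dotpZl.
(* On a trivial space [M] may be negative, hence its absolute value. *)
exists `|M| => y; set z := adjoint T y.
have [->|z0] := eqVneq z 0; first by rewrite normr0 mulr_ge0// ler0c.
rewrite -(@ler_pM2r _ `|z|) ?normr_gt0// -expr2.
rewrite -(ger0_norm (exprn_ge0 2 (normr_ge0 z))).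
have -> : `|z| ^+ 2 = dotp y (T z) by rewrite -dotp_norm dotp_adjointl.
rewrite (le_trans (cauchy_schwarz _ _))// [leRHS]mulrAC mulrC ler_wpM2r//.
by rewrite (le_trans (TM z))// ler_wpM2r// lecR ler_norm.
Qed.

Lemma adjointK {H K} {T : H -> K} :
  bounded_operator T -> adjoint (adjoint T) = T.
Proof. by move=> bT; apply: adjoint_eq => x y; rewrite dotp_adjointr. Qed.

Lemma bounded_operator_id {H} : bounded_operator (id : H -> H).
Proof. by split=> //; exists 1 => x; rewrite mul1r. Qed.

Lemma bounded_operator_comp {H K L} {S : K -> L} {T : H -> K} :
  bounded_operator S -> bounded_operator T -> bounded_operator (S \o T).
Proof.
move=> [Slin [M SM]] [Tlin [N TN]]; split=> [a u v|].
  by rewrite /= Tlin Slin.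
exists (`|M| * N) => x /=; rewrite (le_trans (SM _))// rmorphM/= -mulrA.
apply: (@le_trans _ _ (`|M|%:C * `|T x|)).
  by rewrite ler_wpM2r// lecR ler_norm.
by rewrite ler_wpM2l// ler0c.
Qed.

Lemma bounded_operator_lin {H K} (c : R[i]) {S T : H -> K} :
  bounded_operator S -> bounded_operator T ->
  bounded_operator (fun x => c *: S x + T x).
Proof.
move=> [Slin [M SM]] [Tlin [N TN]]; split=> [a u v|].
  rewrite Slin Tlin !scalerDr !scalerA mulrC -!addrA; congr (_ + _).
  by rewrite addrCA.
have [k ck] : exists k, `|c| = k%:C.
  by exists (complex.Re `|c|); rewrite RRe_real ?normr_real.
exists (k * M + N) => x /=; rewrite (le_trans (ler_normD _ _))//.
rewrite rmorphD rmorphM/= -ck mulrDl lerD// normrZ -mulrA.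
by rewrite ler_wpM2l.
Qed.

Lemma bounded_operator_isometry {H K} {T : H -> K} :
  linear_isometry T -> bounded_operator T.
Proof. by move=> [Tlin iT]; split=> //; exists 1 => x; rewrite mul1r iT. Qed.

Lemma linear_isometry_iter {H} {T : H -> H} n :
  linear_isometry T -> linear_isometry (iter n T).
Proof.
move=> [Tlin iT]; elim: n => [|n [nlin niso]]; first by [].
by split=> [a u v|x]; rewrite !iterS ?nlin ?Tlin ?iT.
Qed.

Lemma dotp_isometry {H K} {T : H -> K} : linear_isometry T ->
  forall x y, dotp (T x) (T y) = dotp x y.
Proof.
move=> [Tlin iT].
have TD x y : T (x + y) = T x + T y by have := Tlin 1 x y; rewrite !scale1r.
have T0 : T 0 = 0 by apply: (addrI (T 0)); rewrite -TD !addr0.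
have TZ a x : T (a *: x) = a *: T x by have := Tlin a x 0; rewrite T0 !addr0.
have Tre x y : complex.Re (dotp (T x) (T y)) = complex.Re (dotp x y).
  have : dotp (T (x + y)) (T (x + y)) = dotp (x + y) (x + y).
    by rewrite !dotp_norm iT.
  rewrite TD !dotpDl !dotpDr !dotp_norm !iT (dotpC (T y)) (dotpC y).
  move=> /(congr1 (@complex.Re R)); rewrite !ReD !Re_conjC; clear; lra.
move=> x y; apply/eqP; rewrite eq_complex Tre eqxx/=.
have := Tre x ('i%C *: y); rewrite TZ !dotpZr.
case: (dotp (T x) _) => a b; case: (dotp x y) => c d /=.
by rewrite !mul0r !mul1r !add0r => /oppr_inj ->.
Qed.

Lemma adjoint_isometryK {H K} {T : H -> K} :
  linear_isometry T -> forall x, adjoint T (T x) = x.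
Proof.
move=> iT x; apply: dotp_inj => y.
by rewrite dotp_adjointl ?dotp_isometry//; exact: bounded_operator_isometry.
Qed.

Lemma adjoint_isometry_le {H K} {T : H -> K} :
  linear_isometry T -> forall y, `|adjoint T y| <= `|y|.
Proof.
move=> iT y; have bT := bounded_operator_isometry iT; set z := adjoint T y.
have [->|z0] := eqVneq z 0; first by rewrite normr0.
rewrite -(@ler_pM2r _ `|z|) ?normr_gt0// -expr2.
rewrite -(ger0_norm (exprn_ge0 2 (normr_ge0 z))).
have -> : `|z| ^+ 2 = dotp y (T z) by rewrite -dotp_norm dotp_adjointl.
by rewrite (le_trans (cauchy_schwarz _ _))// iT.2.
Qed.

Lemma adjoint_iter {H} {T : H -> H} n :
  bounded_operator T -> adjoint (iter n T) = iter n (adjoint T).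
Proof.
move=> bT; apply: adjoint_eq; elim: n => // n IHn x y.
by rewrite iterSr IHn dotp_adjointl// iterS.
Qed.

Lemma cyclic_vectorP {H} {S : set (H -> H)} {x : H} : cyclic_vector S x ->
  forall y (e : R[i]), 0 < e -> exists2 T, S T & `|y - T x| < e.
Proof.
move=> Sx y e e0; have [] := Sx (ball y e).
- by exists y; exact: ballxx.
- exact: ball_open.
- move=> z [+ [T ST Tz]]; rewrite -ball_normE -Tz /=.
  by exists T.
Qed.

End BoundedOperators.

(** * Cesaro means *)

Section Cesaro.
Context {R : realType}.
Implicit Types u v : nat -> R[i].

Definition cesaro_null u : Prop :=
  (fun n => n.+1%:R^-1 * \sum_(0 <= k < n.+1) u k) @ \oo --> (0 : R[i]^o).

(** The averaging operators are contractions of the supremum norm, so that a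
    uniform limit of Cesaro-null sequences is Cesaro-null. *)
Lemma cesaro_null_approx u :
  (forall e : R[i], 0 < e ->
    exists2 v, cesaro_null v & forall k, `|u k - v k| <= e) ->
  cesaro_null u.
Proof.
move=> uv; apply/(@cvgr0Pnorm_lt _ R[i]^o) => e e0.
have e2 : 0 < e / 2 by rewrite divr_gt0.
have [v /(@cvgr0Pnorm_lt _ R[i]^o)/(_ _ e2) + uve] := uv _ e2.
apply: filterS => n vn.
rewrite -(subrK (n.+1%:R^-1 * \sum_(0 <= k < n.+1) v k) (_ * _)).
rewrite (le_lt_trans (ler_normD _ _))// [ltRHS](splitr e) ler_ltD//.
rewrite -mulrBr -sumrB normrM ger0_norm ?invr_ge0//.
rewrite ler_pdivrMl// (le_trans (ler_norm_sum _ _ _))//.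
apply: (@le_trans _ _ (\sum_(0 <= k < n.+1) e / 2)); first exact: ler_sum.
by rewrite sumr_const_nat subn0 -(mulr_natl (e / 2)) lexx.
Qed.

End Cesaro.

(** * The reversible dilation of a homomorphism *)

Section Dilation.
Context {R : realType} {A : cstarType R}.
Context {Phi : A -> A} {H : hilbertType R} {rho : A -> H -> H} {Om : H}
  {V : H -> H}.
Context (hPhi : star_homomorphism Phi) (hrho : representation rho)
  (hV : linear_isometry V) (VOm : V Om = Om)
  (hcovar : forall a, rho (Phi a) = adjoint V \o rho a \o V).

Let bV := bounded_operator_isometry hV.
Let bVn n := bounded_operator_isometry (linear_isometry_iter n hV).

Lemma dotp_rep a x y : dotp (rho a x) y = dotp x (rho (star a) y).
Proof. by rewrite (rep_star hrho) dotp_adjointr//; exact: rep_bounded. Qed.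

(** With [p = rho(a) V x] and [q = rho(Phi a) x], covariance and
    multiplicativity of [Phi] give [<p, p> = <V q, p> = <q, q>], and
    [<V q, V q> = <q, q>] because [V] is isometric; hence [|p - V q| = 0]. *)
Lemma rep_isometry a x : rho a (V x) = V (rho (Phi a) x).
Proof.
set q := rho (Phi a) x; set p := rho a (V x).
have cov b : adjoint V (rho b (V x)) = rho (Phi b) x by rewrite hcovar.
have pp : dotp p p = dotp q q.
  rewrite dotp_rep -[rho (star a) _]/((rho (star a) \o rho a) (V x)).
  rewrite -(repM hrho) -(dotp_adjointr bV) cov shomM// shom_star// repM//.
  by rewrite dotp_rep.
have Vqp : dotp (V q) p = dotp q q by rewrite -(dotp_adjointr bV) cov.
have pVq : dotp p (V q) = dotp q q by rewrite dotpC Vqp -dotpC.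
apply/subr0_eq/eqP; rewrite -dotp_eq0 dotpBl !dotpBr pp Vqp pVq dotp_isometry//.
by rewrite !subrr.
Qed.

Lemma rep_iter_isometry n a x :
  rho a (iter n V x) = iter n V (rho (iter n Phi a) x).
Proof. by elim: n a => // n IHn a; rewrite iterS rep_isometry IHn -iterSr. Qed.

Lemma iter_fixed n : iter n V Om = Om.
Proof. by elim: n => // n /= ->. Qed.

Lemma adjoint_iter_isometryK n x : iter n (adjoint V) (iter n V x) = x.
Proof.
by rewrite -adjoint_iter// adjoint_isometryK//; exact: linear_isometry_iter.
Qed.

(** The images of [Om] under the generators [V^n rho(a) V^{*n}]; the powers of
    [V^*] disappear from the formula because [V^*] fixes [Om]. *)
Definition vacuum_orbit : set H :=
  [set x | exists n a, x = iter n V (rho a Om)].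

Lemma vacuum_orbit_shift n a m :
  iter n V (rho a Om) = iter (m + n) V (rho (iter m Phi a) Om).
Proof. by rewrite addnC iterD -rep_iter_isometry iter_fixed. Qed.

Lemma vacuum_orbit2 {x y} : vacuum_orbit x -> vacuum_orbit y ->
  exists n a b, x = iter n V (rho a Om) /\ y = iter n V (rho b Om).
Proof.
move=> [n [a ->]] [m [b ->]].
exists (m + n)%N, (iter m Phi a), (iter n Phi b).
by rewrite -vacuum_orbit_shift addnC -vacuum_orbit_shift.
Qed.

Lemma vacuum_orbit_lin c x y :
  vacuum_orbit x -> vacuum_orbit y -> vacuum_orbit (c *: x + y).
Proof.
move=> tx ty; have [n [a [b [-> ->]]]] := vacuum_orbit2 tx ty.
exists n, (c *: a + b).
by rewrite (rep_linear hrho) (linear_isometry_iter n hV).1.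
Qed.

Lemma vacuum_orbit_generator n a x : vacuum_orbit x ->
  vacuum_orbit ((iter n V \o rho a \o iter n (adjoint V)) x).
Proof.
move=> [m [b ->]]; rewrite (vacuum_orbit_shift _ _ n) iterD/=.
rewrite adjoint_iter_isometryK rep_iter_isometry -iterD.
by exists (n + m)%N, (iter m Phi a * iter n Phi b); rewrite repM.
Qed.

Lemma adjoint_generator n a :
  adjoint (iter n V \o rho a \o iter n (adjoint V)) =
  iter n V \o rho (star a) \o iter n (adjoint V).
Proof.
apply: adjoint_eq => x y /=.
by rewrite -!adjoint_iter// -dotp_adjointr// dotp_rep starK dotp_adjointl.
Qed.

(** Invariance under adjoints is part of the statement because it is needed for
    the operators leaving the subspace invariant to form a *-algebra. *)
Lemma covariance_algebra_vacuum_orbit : covariance_algebra rho V `<=`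
  [set X | [/\ bounded_operator X,
    forall x, vacuum_orbit x -> vacuum_orbit (X x) &
    forall x, vacuum_orbit x -> vacuum_orbit (adjoint X x)]].
Proof.
apply: smallest_sub; last first.
  move=> _ [n _ [a _ <-]]; split.
  - apply: bounded_operator_comp.
      by apply: bounded_operator_comp => //; exact: rep_bounded.
    by rewrite -adjoint_iter//; exact: bounded_operator_adjoint.
  - by move=> x; exact: vacuum_orbit_generator.
  - by move=> x; rewrite adjoint_generator; exact: vacuum_orbit_generator.
split.
- by move=> X [].
- split=> //; first exact: bounded_operator_id.
  by move=> x; rewrite (@adjoint_eq _ _ _ id id).
- move=> c X Y [bX tX tX'] [bY tY tY']; split.
  + exact: bounded_operator_lin.
  + by move=> x tx; apply: vacuum_orbit_lin; [exact: tX|exact: tY].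
  + move=> x tx.
    rewrite (adjoint_eq _ (fun y => Num.conj c *: adjoint X y + adjoint Y y)).
      by apply: vacuum_orbit_lin; [exact: tX'|exact: tY'].
    by move=> y z; rewrite dotpDl dotpZl conjCK !dotp_adjointl// dotpDr dotpZr.
- move=> X Y [bX tX tX'] [bY tY tY']; split.
  + exact: bounded_operator_comp.
  + by move=> x tx; apply/tX/tY.
  + move=> x tx; rewrite (adjoint_eq _ (adjoint Y \o adjoint X)).
      by apply/tY'/tX'.
    by move=> y z; rewrite /= !dotp_adjointl.
- move=> X [bX tX tX']; split=> //; first exact: bounded_operator_adjoint.
  by rewrite adjointK.
Qed.

Context (cycOm : cyclic_vector (covariance_algebra rho V) Om).

Lemma vacuum_orbit_dense x (e : R[i]) : 0 < e ->
  exists2 y, vacuum_orbit y & `|x - y| < e.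
Proof.
move=> e0; have [T ST xT] := cyclic_vectorP cycOm x e e0.
exists (T Om) => //; have [_ tT _] := covariance_algebra_vacuum_orbit _ ST.
by apply: tT; exists 0%N, 1; rewrite (rep1 hrho).
Qed.

Context {phi : A -> R[i]} (phi1 : phi 1 = 1)
  (phiE : forall a, phi a = dotp Om (rho a Om)).

Lemma norm_vacuum : `|Om| = 1.
Proof.
apply/eqP; rewrite -sqrp_eq1// -dotp_norm -[X in dotp _ X]/(id Om).
by rewrite -(rep1 hrho) -phiE phi1.
Qed.

Definition vector_correlation k (x y : H) : R[i] :=
  dotp x (iter k (adjoint V) y) - dotp x Om * dotp Om y.

Lemma adjoint_iter_le k y : `|iter k (adjoint V) y| <= `|y|.
Proof.
rewrite -adjoint_iter//; apply: adjoint_isometry_le.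
exact: linear_isometry_iter.
Qed.

Lemma vector_correlation_le k x y :
  `|vector_correlation k x y| <= 2 * `|x| * `|y|.
Proof.
rewrite (le_trans (ler_normB _ _))// -mulrA mulr2n mulrDl mul1r lerD//.
  rewrite (le_trans (cauchy_schwarz _ _))// ler_wpM2l//.
  exact: adjoint_iter_le.
rewrite normrM ler_pM// (le_trans (cauchy_schwarz _ _))// norm_vacuum.
  by rewrite mulr1.
by rewrite mul1r.
Qed.

Lemma vector_correlationBl k x x' y : vector_correlation k (x - x') y =
  vector_correlation k x y - vector_correlation k x' y.
Proof. rewrite /vector_correlation !dotpBl; ring. Qed.

Lemma vector_correlationBr k x y y' : vector_correlation k x (y - y') =
  vector_correlation k x y - vector_correlation k x y'.
Proof.
have E z : dotp x (iter k (adjoint V) z) = dotp (iter k V x) z.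
  by rewrite -adjoint_iter// dotp_adjointr.
rewrite /vector_correlation !E !dotpBr; ring.
Qed.

(** The isometry removes the common power [V^n], and [V^{*k} rho(b) Om] is
    [rho(Phi^k b) Om] because [rho(b) V^k = V^k rho(Phi^k b)]. *)
Lemma vector_correlation_vacuum_orbit n a b k :
  vector_correlation k (iter n V (rho a Om)) (iter n V (rho b Om)) =
  correlation *%R Phi phi (star a) b k.
Proof.
have iVn := linear_isometry_iter n hV; have iVk := linear_isometry_iter k hV.
rewrite /vector_correlation /correlation; congr (_ - _ * _).
- rewrite -adjoint_iter// dotp_adjointr// -iterD addnC iterD dotp_isometry//.
  rewrite -dotp_adjointr// -[X in rho b X](iter_fixed k) rep_iter_isometry.
  by rewrite adjoint_isometryK// dotp_rep phiE repM.
- by rewrite -[X in dotp _ X](iter_fixed n) dotp_isometry// dotp_rep phiE.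
- by rewrite -[X in dotp X _](iter_fixed n) dotp_isometry// phiE.
Qed.

Lemma dilation_correlation X Y k : bounded_operator X ->
  correlation (fun S T : H -> H => S \o T) (dilation_map V) (vector_state Om)
    X Y k = vector_correlation k (adjoint X Om) (Y Om).
Proof.
move=> bX; rewrite /correlation /vector_state /vector_correlation.
congr (_ - _ * _); last by rewrite dotp_adjointl.
rewrite [RHS]dotp_adjointl//=; congr (dotp _ (X _)).
suff -> : iter k (dilation_map V) Y = iter k (adjoint V) \o Y \o iter k V.
  by rewrite /= iter_fixed.
elim: k => // k IHk; apply/funext => x.
by rewrite iterS IHk /dilation_map/= -iterSr.
Qed.

(** Ergodicity and weak mixing are treated at once: they are the cases in which
    [F] is the identity and the modulus. *)
Context (F : R[i] -> R[i]) (Flip : forall a b, `|F a - F b| <= `|a - b|).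

Lemma cesaro_null_dense (c : nat -> H -> R[i]) (M : R[i]) : 0 <= M ->
  (forall k x y, `|c k x - c k y| <= M * `|x - y|) ->
  (forall x, vacuum_orbit x -> cesaro_null (fun k => F (c k x))) ->
  forall x, cesaro_null (fun k => F (c k x)).
Proof.
move=> M0 cM ct x; apply: cesaro_null_approx => e e0.
have M1 : 0 < M + 1 by rewrite ltr_wpDl.
have [y ty xy] := vacuum_orbit_dense x (e / (M + 1)) (divr_gt0 e0 M1).
exists (fun k => F (c k y)); first exact: ct.
move=> k; rewrite (le_trans (Flip _ _))// (le_trans (cM k x y))//.
rewrite (@le_trans _ _ ((M + 1) * `|x - y|))//.
  by rewrite ler_wpM2r// lerDl.
by rewrite mulrC -ler_pdivlMr// ltW.
Qed.

Lemma dilation_mixing :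
  (forall a b, cesaro_null (fun k => F (correlation *%R Phi phi a b k))) ->
  forall X Y, dilation_algebra rho V X -> dilation_algebra rho V Y ->
  cesaro_null (fun k => F (correlation (fun S T : H -> H => S \o T)
    (dilation_map V) (vector_state Om) X Y k)).
Proof.
move=> mixA X Y [bX _] _.
rewrite (_ : (fun k => _) =
    fun k => F (vector_correlation k (adjoint X Om) (Y Om))); last first.
  by apply/funext => k; rewrite dilation_correlation.
move: (adjoint X Om) (Y Om) => x y.
apply: (cesaro_null_dense (fun k x => vector_correlation k x y) (2 * `|y|)).
- by rewrite mulr_ge0.
- move=> k u v; rewrite -vector_correlationBl.
  by rewrite (le_trans (vector_correlation_le _ _ _))// mulrAC.
(* Both variables are now moved to the dense subspace, one after the other. *)
move=> {}x tx.
apply: (cesaro_null_dense (fun k y => vector_correlation k x y) (2 * `|x|)).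
- by rewrite mulr_ge0.
- by move=> k u v; rewrite -vector_correlationBr vector_correlation_le.
move=> {}y ty; have [n [a [b [-> ->]]]] := vacuum_orbit2 tx ty.
rewrite (_ : (fun k => _) = fun k => F (correlation *%R Phi phi (star a) b k)).
  exact: mixA.
by apply/funext => k; rewrite vector_correlation_vacuum_orbit.
Qed.

End Dilation.

Theorem proposition6 (R : realType) (A : cstarType R)
    (Phi : A -> A) (phi : A -> R[i])
    (hsys : cstar_dynamical_system Phi phi)
    (hhom : star_homomorphism Phi)
    (hadj : exists Phis : A -> A, phi_adjoint Phi phi Phis)
    (Hphi : hilbertType R) (piphi : A -> Hphi -> Hphi) (Omphi : Hphi)
    (hGNS : GNS_representation phi piphi Omphi)
    (hcyc : cyclic_vector (commutant (range piphi)) Omphi)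
    (U : Hphi -> Hphi) (hU : GNS_contraction Phi piphi Omphi U)
    (Hinf : hilbertType R) (piinf : A -> Hinf -> Hinf) (Ominf : Hinf)
    (V : Hinf -> Hinf) (Z0 : Hphi -> Hinf)
    (hcov : covariant_GNS_representation Phi phi piphi Omphi U
              piinf Ominf V Z0) :
  (ergodic *%R [set: A] Phi phi ->
   ergodic (fun X Y : Hinf -> Hinf => X \o Y) (dilation_algebra piinf V)
     (dilation_map V) (vector_state Ominf)) /\
  (weakly_mixing *%R [set: A] Phi phi ->
   weakly_mixing (fun X Y : Hinf -> Hinf => X \o Y) (dilation_algebra piinf V)
     (dilation_map V) (vector_state Ominf)).
Proof.
have [hrho hV _ _ _ _ VOm cycOm hcovar phiE] := hcov.
have phi1 := state1 (cds_state hsys).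
have mixing := dilation_mixing hhom hrho hV VOm hcovar cycOm phi1 phiE.
split=> mixA X Y MX MY.
- apply: (mixing id _ _ X Y MX MY) => // a b.
  exact: (mixA a b).
- apply: (mixing Num.norm _ _ X Y MX MY) => [a b|a b].
    exact: ler_dist_dist.
  exact: (mixA a b).
Qed.
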